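(* Let $p \in \{0\} \cup [1,\infty)$, let $A := (a_{j,k})_{j \in \mathbb{N}, k \in \mathbb{N}}$ be a Köthe matrix on $\mathbb{N}$ with nonzero entries, and consider the Köthe sequence space $X := \lambda_p(A,\mathbb{N})$. Let $w := (w_n)_{n \in \mathbb{N}}$ be a sequence of nonzero scalars such that the unilateral weighted backward shift $B_w$ is a well-defined operator on $X$. Then $B_w$ is Li-Yorke chaotic if and only if there exists $k \in \mathbb{N}$ such that $$\sup\Big\{\frac{a_{i,k} |w_i \cdots w_j|}{a_{j+1,\ell}} : i,j \in \mathbb{N}, i \leq j\Big\} = \infty \ \text{ for all } \ell \in \mathbb{N}.$$
   Context: $\mathbb{K}$ denotes $\mathbb{R}$ or $\mathbb{C}$ (the scalar field), and $\mathbb{N} = \{1,2,3,\ldots\}$. A Köthe matrix on $\mathbb{N}$ is a family of scalars $A = (a_{j,k})_{j \in \mathbb{N},k\in\mathbb{N}}$ such that for each $j$ there is $k$ with $a_{j,k} > 0$, and $0 \leq a_{j,k} \leq a_{j,k+1}$ for all $j,k$. The Köthe sequence space $\lambda_p(A,\mathbb{N})$ is the Fréchet space defined as follows. If $p \in [1,\infty)$, it is $\{(x_j)_{j} \in \mathbb{K}^{\mathbb{N}} : \sum_{j \in \mathbb{N}} |a_{j,k}x_j|^p < \infty \text{ for all } k \in \mathbb{N}\}$ with the seminorms $\|x\|_k := (\sum_{j\in\mathbb{N}} |a_{j,k}x_j|^p)^{1/p}$, $k \in \mathbb{N}$. If $p = 0$, it is $\{(x_j)_j \in \mathbb{K}^{\mathbb{N}}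 : \lim_{j \to \infty} a_{j,k}x_j = 0 \text{ for all } k \in \mathbb{N}\}$ with the seminorms $\|x\|_k := \sup_{j\in\mathbb{N}} |a_{j,k}x_j|$, $k \in \mathbb{N}$. The unilateral weighted backward shift is $B_w(x_1,x_2,x_3,\ldots) := (w_1x_2,w_2x_3,w_3x_4,\ldots)$; it is a well-defined operator on $X$ if it maps $X$ into itself (it is then automatically continuous). For $i \leq j$, $w_i\cdots w_j$ denotes the product of all $w_l$ with $i \leq l \leq j$. A continuous map $g : M \to M$ on a metric space $(M,d)$ is Li-Yorke chaotic if there is an uncountable set $S \subset M$ such that for all distinct $x,y \in S$, $\liminf_{n \to \infty} d(g^n(x),g^n(y)) = 0$ and $\limsup_{n\to\infty} d(g^n(x),g^n(y)) > 0$. A Fréchet space is regarded as a metric space via any translation-invariant metric inducing its topology. *)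

(* Defs.v *)
(* The index set {1, 2, 3, ...} is represented by [nat], index n standing for
   n + 1, for sequences, matrix rows, and seminorms alike. *)
From mathcomp Require Import all_boot all_order all_algebra.
From mathcomp Require Import all_classical all_reals all_analysis.
From mathcomp Require Import complex.
Set Implicit Arguments.
Unset Strict Implicit.
Unset Printing Implicit Defensive.
Import Order.TTheory GRing.Theory Num.Theory.
Import numFieldNormedType.Exports.
Local Open Scope classical_set_scope.
Local Open Scope ring_scope.

Variant scalar_kind := RealScalars | ComplexScalars.

Definition scalar_field (R : realType) (c : scalar_kind) : numFieldType :=
  match c with
  | RealScalars => R
  | ComplexScalars => R[i]
  end.

(* The MathComp norm of [R[i]] takes its values in [R[i]]; this is the
   R-valued modulus. *)
Definition sabs (R : realType) (c : scalar_kind) : scalar_field R c -> R :=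
  match c return scalar_field R c -> R with
  | RealScalars => fun x : R => `|x|
  | ComplexScalars => fun z : R[i] => Normc.normc z
  end.

Section Metric.
Context {R : realType} {T : Type}.
Implicit Types (M : set T) (d : T -> T -> R) (g : T -> T).

(* Metric notions for a set M of an ambient type; the values of d and g
   outside M are irrelevant. *)
Definition metric_on M d : Prop :=
  [/\ forall x y, M x -> M y -> 0 <= d x y,
      forall x y, M x -> M y -> (d x y = 0 <-> x = y),
      forall x y, M x -> M y -> d x y = d y x &
      forall x y z, M x -> M y -> M z -> d x z <= d x y + d y z].

Definition metric_open M d (U : set T) : Prop :=
  U `<=` M /\
  forall x, U x -> exists2 e : R, 0 < e & forall y, M y -> d x y < e -> U y.

Definition metric_continuous M d g : Prop :=
  forall x, M x -> forall e : R, 0 < e ->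
  exists2 r : R, 0 < r & forall y, M y -> d x y < r -> d (g x) (g y) < e.

Definition li_yorke_chaotic M d g : Prop :=
  [/\ set_fun M M g, metric_continuous M d g &
      exists S : set T,
        [/\ S `<=` M, ~ countable S &
            forall x y, S x -> S y -> x <> y ->
              limn_einf (fun n => (d (iter n g x) (iter n g y))%:E) = 0%E /\
              (0 < limn_esup (fun n => (d (iter n g x) (iter n g y))%:E))%E]].

End Metric.

Definition kothe_matrix (R : realType) (a : nat -> nat -> R) : Prop :=
  (forall j, exists k, 0 < a j k) /\ (forall j k, 0 <= a j k <= a j k.+1).

Section Kothe.
Context {R : realType} {c : scalar_kind}.
Variables (p : R) (a : nat -> nat -> R).
Local Notation K := (scalar_field R c).

(* Since a_{j,k} >= 0 for a Koethe matrix, |a_{j,k} x_j| is written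
   a_{j,k} |x_j|.  Here p is 0 or at least 1, and p = 0 is the c_0-type case. *)
Definition kothe_space : set (nat -> K) :=
  [set x | forall k : nat,
     if p == 0 then (fun j => a j k * sabs (x j)) @ \oo --> (0 : R)
     else (\sum_(0 <= j <oo) ((a j k * sabs (x j)) `^ p)%:E < +oo)%E].

(* [sup] and [fine] give the intended values for x in [kothe_space]: the set
   is then bounded and the sum finite. *)
Definition kothe_seminorm (k : nat) (x : nat -> K) : R :=
  if p == 0 then sup (range (fun j => a j k * sabs (x j)))
  else fine (\sum_(0 <= j <oo) ((a j k * sabs (x j)) `^ p)%:E)%E `^ p^-1.

(* The open sets of the locally convex topology of [kothe_space]: basic
   neighbourhoods are balls for finitely many seminorms. *)
Definition kothe_open (U : set (nat -> K)) : Prop :=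
  U `<=` kothe_space /\
  forall x, U x -> exists m : nat, exists2 e : R, 0 < e &
    forall y, kothe_space y ->
      (forall k, (k <= m)%N ->
         kothe_seminorm k (fun j => y j - x j) < e) -> U y.

Definition kothe_metric (d : (nat -> K) -> (nat -> K) -> R) : Prop :=
  [/\ metric_on kothe_space d,
      forall x y z, kothe_space x -> kothe_space y -> kothe_space z ->
        d (fun j => x j + z j) (fun j => y j + z j) = d x y &
      forall U, metric_open kothe_space d U <-> kothe_open U].

End Kothe.

Definition bshift (R : realType) (c : scalar_kind) (w : nat -> scalar_field R c)
    (x : nat -> scalar_field R c) : nat -> scalar_field R c :=
  fun n => w n * x n.+1.

(* Main.v *)
(* If for every k some supremum, with parameter l, is finite, then ||B^n x||_k is at most a constant times
   the l-th seminorm of the tail of x beyond n, so every orbit tends to 0 and no pair is Li-Yorke.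

   Otherwise one builds a vector x supported on a sparse set q_0 < q_1 < ..., chosen so that
   at a time n_t < q_t the q_t-coordinate lands at an index i_t where it has weight exactly 1
   for the k-th seminorm, while all its earlier images, up to time q_{t-1} + 1, have size at
   most 2^-q_{t-1}. At time q_t + 1 the first coordinates of the support have been shifted
   out, hence B^{q_t + 1} x -> 0 whereas ||B^{n_t} x||_k >= 1, and the real multiples of x form an
   uncountable scrambled set. The pairs (i_t, q_t) exist because B is bounded from
   seminorm to seminorm, which follows from well-definedness by testing B on a vector
   of the same sparse form. *)
Require Import Defs.
From mathcomp Require Import all_boot all_order all_algebra.
From mathcomp Require Import all_classical all_reals all_analysis.
From mathcomp Require Import complex ring lra.
Import Order.TTheory GRing.Theory Num.Theory.
Import numFieldNormedType.Exports.
Set Implicit Arguments.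
Unset Strict Implicit.
Unset Printing Implicit Defensive.
Local Open Scope classical_set_scope.
Local Open Scope ring_scope.

(** * Nonnegative real sequences in l^p or c_0 *)

Section SequenceNorm.
Context {R : realType}.
Implicit Types (p : R) (u v : nat -> R).

(** For u_j = a_{j,k} |x_j|, this and [seq_norm] unfold to the k-th clause of [kothe_space] and to
    [kothe_seminorm], so that the case split on p stays within this section. *)
Definition seq_mem p u : Prop :=
  if p == 0 then u @ \oo --> (0 : R)
  else (\sum_(0 <= j <oo) ((u j) `^ p)%:E < +oo)%E.

Definition seq_norm p u : R :=
  if p == 0 then sup (range u)
  else fine (\sum_(0 <= j <oo) ((u j) `^ p)%:E)%E `^ p^-1.

Lemma powR_root (p x : R) : p != 0 -> 0 <= x -> (x `^ p) `^ p^-1 = x.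
Proof. by move=> p0 x0; rewrite -powRrM divff// powRr1. Qed.

Lemma nneseries_powR_ge0 p u : (0 <= \sum_(0 <= j <oo) ((u j) `^ p)%:E)%E.
Proof. by apply: nneseries_ge0 => n _ _; rewrite lee_fin powR_ge0. Qed.

Lemma nneseries_powR_fin_num p u : (\sum_(0 <= j <oo) ((u j) `^ p)%:E < +oo)%E ->
  (\sum_(0 <= j <oo) ((u j) `^ p)%:E)%E \is a fin_num.
Proof. by move=> uoo; rewrite ge0_fin_numE// nneseries_powR_ge0. Qed.

Lemma cvg0_has_ubound u : u @ \oo --> (0 : R) -> has_ubound (range u).
Proof.
move=> /cvgP /cvg_has_ub [M Mu]; exists M => _ [j _ <-].
by apply: le_trans (Mu `|u j| _); [exact: ler_norm|exists j].
Qed.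

Lemma seq_norm_ge p u j : p = 0 \/ 1 <= p -> (forall i, 0 <= u i) ->
  seq_mem p u -> u j <= seq_norm p u.
Proof.
rewrite /seq_mem /seq_norm => hp u0; case: (eqVneq p 0) => [_|p0].
  by move=> /cvg0_has_ubound ubu; apply: ub_le_sup => //; exists j.
have p1 : 1 <= p by case: hp => // p00; rewrite p00 eqxx in p0.
move=> uoo; rewrite -[leLHS](@powR_root p)//.
apply: ge0_ler_powR; rewrite ?nnegrE ?powR_ge0 ?invr_ge0 ?fine_ge0 ?nneseries_powR_ge0//.
  exact: le_trans ler01 p1.
rewrite -lee_fin fineK ?nneseries_powR_fin_num//.
apply: le_trans (nneseries_lim_ge j.+1 _); last first.
  by move=> n _; rewrite lee_fin powR_ge0.
by rewrite big_nat_recr//= leeDr// sume_ge0// => i _; rewrite lee_fin powR_ge0.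
Qed.

Lemma seq_mem_dom p u v C : p = 0 \/ 1 <= p -> 0 <= C ->
  (forall j, 0 <= v j) -> (forall j, 0 <= u j <= C * v j) ->
  seq_mem p v -> seq_mem p u /\ seq_norm p u <= C * seq_norm p v.
Proof.
move=> hp C0 v0 uv mv; have nv := fun j => seq_norm_ge j hp v0 mv.
move: mv nv; rewrite /seq_mem /seq_norm; case: (eqVneq p 0) => [_|p0] mv nv.
  split.
    apply: (@squeeze_cvgr _ _ _ _ (fun=> 0) (fun j => C * v j)).
    - by apply: nearW.
    - exact: cvg_cst.
    - by rewrite -(mulr0 C); apply: cvgMr.
  apply: ge_sup; first by exists (u 0%N), 0%N.
  move=> _ [j _ <-]; have /andP[_ /le_trans] := uv j; apply.
  by rewrite ler_wpM2l.
have p1 : 1 <= p by case: hp => // p00; rewrite p00 eqxx in p0.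
have p00 : 0 <= p by rewrite (le_trans ler01).
have le : (\sum_(0 <= j <oo) ((u j) `^ p)%:E <=
           (C `^ p)%:E * \sum_(0 <= j <oo) ((v j) `^ p)%:E)%E.
  rewrite -nneseriesZl; last by move=> i _; rewrite lee_fin powR_ge0.
  apply: lee_nneseries; first by move=> i _ _; rewrite lee_fin powR_ge0.
  move=> n _; rewrite -EFinM lee_fin -powRM//; have /andP[un0 unv] := uv n.
  by rewrite ge0_ler_powR// nnegrE// mulr_ge0.
have muoo : (\sum_(0 <= j <oo) ((u j) `^ p)%:E < +oo)%E.
  apply: le_lt_trans le _; rewrite -[X in (_ * X)%E]fineK ?nneseries_powR_fin_num//.
  by rewrite -EFinM ltry.
split => //.
rewrite -[X in X * _](@powR_root p)// -powRM ?powR_ge0//; last first.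
  by rewrite fine_ge0// nneseries_powR_ge0.
apply: ge0_ler_powR; rewrite ?nnegrE ?mulr_ge0 ?powR_ge0 ?invr_ge0 ?fine_ge0 ?nneseries_powR_ge0//.
by rewrite -lee_fin EFinM !fineK ?nneseries_powR_fin_num.
Qed.

Lemma seq_mem_tail p u (eps : R) : p = 0 \/ 1 <= p -> (forall j, 0 <= u j) ->
  seq_mem p u -> 0 < eps ->
  exists N : nat, forall n, (N <= n)%N ->
    seq_mem p (fun j => u (j + n)%N) /\ seq_norm p (fun j => u (j + n)%N) < eps.
Proof.
rewrite /seq_mem /seq_norm => hp u0 mu e0.
move: mu; case: (eqVneq p 0) => [_|p0] mu.
  (* Half of [eps], because a supremum of terms below a bound need not be strictly below it. *)
  have e20 : 0 < eps / 2 by rewrite divr_gt0.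
  have /cvgrPdist_lt /(_ _ e20) [N _ hN] := mu.
  exists N => n Nn; split.
    by move: mu; rewrite -(cvg_shiftn n).
  apply: (@le_lt_trans _ _ (eps / 2)); last by lra.
  apply: ge_sup; first by exists (u (0 + n)%N), 0%N.
  move=> _ [j _ <-].
  have := hN (j + n)%N; rewrite sub0r normrN ger0_norm// => hn.
  by apply/ltW/hn => /=; rewrite (leq_trans Nn)// leq_addl.
have p1 : 1 <= p by case: hp => // p00; rewrite p00 eqxx in p0.
have p00 : 0 < p by rewrite (lt_le_trans ltr01).
have ge0 (i : nat) : xpredT i -> (0 <= (u i `^ p)%:E)%E.
  by move=> _; rewrite lee_fin powR_ge0.
have := nneseries_tail_cvg mu ge0.
move=> /fine_cvgP [[N1 _ fin] /cvgrPdist_lt].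
have ep0 : 0 < eps `^ p by rewrite powR_gt0.
move=> /(_ _ ep0) [N2 _ hN]; exists (maxn N1 N2) => n; rewrite geq_max => /andP[n1 n2].
rewrite (nneseries_addn (f := fun i => (u i `^ p)%:E)); last first.
  by move=> i; rewrite lee_fin powR_ge0.
have t0 : (0 <= \sum_(n <= i <oo) (u i `^ p)%:E)%E.
  by apply: nneseries_ge0 => i _ _; rewrite lee_fin powR_ge0.
split; first by rewrite -ge0_fin_numE//; exact: fin.
have := hN n n2; rewrite /= sub0r normrN ger0_norm ?fine_ge0// => lt.
rewrite -[ltRHS](@powR_root p) ?(ltW e0)//.
by apply: gt0_ltr_powR; rewrite ?nnegrE ?invr_gt0 ?powR_ge0 ?fine_ge0.
Qed.

(** A summable sequence lies in c_0 and in every l^p: each term is at most S, so u_j^p <= u_j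
    S^(p-1). Sparse vectors can thus be estimated by plain sums, whatever p is. *)
Lemma seq_mem_bounded_sums p u S : p = 0 \/ 1 <= p -> (forall j, 0 <= u j) ->
  (forall n, \sum_(0 <= j < n) u j <= S) -> seq_mem p u /\ seq_norm p u <= S.
Proof.
rewrite /seq_mem /seq_norm => hp u0 uS.
have uj j : u j <= S.
  apply: le_trans (uS j.+1); rewrite big_nat_recr//= lerDr.
  by rewrite sumr_ge0.
have S0 : 0 <= S by exact: le_trans (u0 0%N) (uj 0%N).
case: (eqVneq p 0) => [_|p0].
  split; last first.
    by apply: ge_sup; [exists (u 0%N), 0%N|move=> _ [j _ <-]].
  apply: cvg_series_cvg_0; apply: nondecreasing_is_cvgn.
    apply/nondecreasing_seqP => n; rewrite /series/= big_nat_recr//= lerDl.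
    exact: u0.
  by exists S => _ [n _ <-]; exact: uS.
have p1 : 1 <= p by case: hp => // p00; rewrite p00 eqxx in p0.
have p00 : 0 < p by rewrite (lt_le_trans ltr01).
have le : (\sum_(0 <= j <oo) ((u j) `^ p)%:E <= (S `^ p)%:E)%E.
  apply: lime_le.
    by apply: is_cvg_nneseries => i _ _; rewrite lee_fin powR_ge0.
  apply: nearW => n; rewrite sumEFin lee_fin -mulr_powRB1//.
  apply: (@le_trans _ _ (\sum_(0 <= j < n) u j * S `^ (p - 1))).
    apply: ler_sum => j _; rewrite -mulr_powRB1// ler_wpM2l//.
    by apply: ge0_ler_powR; rewrite ?nnegrE ?subr_ge0.
  by rewrite -mulr_suml ler_wpM2r// powR_ge0.
have muoo : (\sum_(0 <= j <oo) ((u j) `^ p)%:E < +oo)%E.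
  by apply: le_lt_trans le _; rewrite ltry.
split => //; rewrite -[leRHS](@powR_root p)//.
apply: ge0_ler_powR; rewrite ?nnegrE ?powR_ge0 ?invr_ge0 ?(ltW p00) ?fine_ge0 ?nneseries_powR_ge0//.
by rewrite -lee_fin fineK ?nneseries_powR_fin_num.
Qed.

(** Only membership is claimed, so the crude bound (u + v)^p <= 2^p (u^p + v^p) replaces Minkowski's
    inequality. *)
Lemma seq_memD p u v : p = 0 \/ 1 <= p ->
  (forall j, 0 <= u j) -> (forall j, 0 <= v j) ->
  seq_mem p u -> seq_mem p v -> seq_mem p (fun j => u j + v j).
Proof.
rewrite /seq_mem => hp u0 v0; case: (eqVneq p 0) => [_|p0] mu mv.
  by rewrite -(addr0 0); apply: cvgD.
have p1 : 1 <= p by case: hp => // p00; rewrite p00 eqxx in p0.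
have p00 : 0 < p by rewrite (lt_le_trans ltr01).
have ge0 (f : nat -> R) (i : nat) : (0 <= (f i `^ p)%:E)%E.
  by rewrite lee_fin powR_ge0.
apply: (@le_lt_trans _ _ (\sum_(0 <= j <oo) ((2 `^ p)%:E * ((u j `^ p)%:E + (v j `^ p)%:E)))%E).
  apply: lee_nneseries => [i _ _|j _]; first by rewrite lee_fin powR_ge0.
  rewrite -EFinD -EFinM lee_fin.
  have [uv|vu] := leP (u j) (v j).
    apply: (@le_trans _ _ ((2 * v j) `^ p)).
      by apply: ge0_ler_powR; rewrite ?nnegrE ?addr_ge0 ?mulr_ge0//; lra.
    by rewrite powRM// ler_wpM2l ?powR_ge0// lerDr powR_ge0.
  apply: (@le_trans _ _ ((2 * u j) `^ p)).
    by apply: ge0_ler_powR; rewrite ?nnegrE ?addr_ge0 ?mulr_ge0//; lra.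
  by rewrite powRM// ler_wpM2l ?powR_ge0// lerDl powR_ge0.
rewrite nneseriesZl; last by move=> i _; rewrite adde_ge0.
rewrite nneseriesD//.
rewrite -(fineK (nneseries_powR_fin_num mu)) -(fineK (nneseries_powR_fin_num mv)).
by rewrite -EFinD -EFinM ltry.
Qed.

Lemma seq_norm_succ_le p u :
  p = 0 \/ 1 <= p -> (forall j, 0 <= u j) -> seq_mem p u ->
  seq_mem p (fun j => u j.+1) /\ seq_norm p (fun j => u j.+1) <= seq_norm p u.
Proof.
rewrite /seq_mem /seq_norm => hp u0; case: (eqVneq p 0) => [_|p0] mu.
  split; first by move: mu; rewrite -(cvg_shiftS u).
  apply: ge_sup; first by exists (u 1%N), 0%N.
  by move=> _ [j _ <-]; apply: ub_le_sup; [exact: cvg0_has_ubound|exists j.+1].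
have p1 : 1 <= p by case: hp => // p00; rewrite p00 eqxx in p0.
have p00 : 0 <= p by rewrite (le_trans ler01).
have le : (\sum_(0 <= j <oo) ((u j.+1) `^ p)%:E <= \sum_(0 <= j <oo) ((u j) `^ p)%:E)%E.
  rewrite [leRHS](@nneseries_split _ _ 0 1); last first.
    by move=> k _; rewrite lee_fin powR_ge0.
  rewrite add0n big_nat1 -nneseries_addn; last first.
    by move=> k; rewrite lee_fin powR_ge0.
  under [in leRHS]eq_eseriesr do rewrite addn1.
  by rewrite leeDr// lee_fin powR_ge0.
split; first exact: le_lt_trans le mu.
apply: ge0_ler_powR; rewrite ?nnegrE ?invr_ge0 ?fine_ge0 ?nneseries_powR_ge0//.
have mu1 := le_lt_trans le mu.
by apply: fine_le le; rewrite nneseries_powR_fin_num.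
Qed.

End SequenceNorm.

(** * The modulus on the real or complex scalars *)

Section Scalars.
Context {R : realType} {c : scalar_kind}.
Implicit Types x y : scalar_field R c.

Lemma sabs_ge0 x : 0 <= sabs x.
Proof. by case: c x => x /=; [exact: normr_ge0|case: x => a b; exact: sqrtr_ge0]. Qed.

Lemma sabsM x y : sabs (x * y) = sabs x * sabs y.
Proof. by case: c x y => x y /=; [exact: normrM|exact: Normc.normcM]. Qed.

Lemma le_sabsD x y : sabs (x + y) <= sabs x + sabs y.
Proof. by case: c x y => x y /=; [exact: ler_normD|exact: le_normcD]. Qed.

Lemma sabs0 : sabs (0 : scalar_field R c) = 0.
Proof. by case: c; [exact: normr0|exact: Normc.normc0]. Qed.

Lemma sabs_gt0 x : x != 0 -> 0 < sabs x.
Proof.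
move=> x0; rewrite lt_neqAle sabs_ge0 andbT eq_sym; apply: contra_neq x0.
by case: c x => x /=; [exact: normr0_eq0|exact: Normc.eq0_normc].
Qed.

Lemma sabs1 : sabs (1 : scalar_field R c) = 1.
Proof. by case: c; [exact: normr1|exact: Normc.normc1]. Qed.

Lemma sabsN x : sabs (- x) = sabs x.
Proof. by case: c x => x /=; [exact: normrN|exact: normcN]. Qed.

Lemma sabs_prod_gt0 (I : Type) (r : seq I) (F : I -> scalar_field R c) :
  (forall i, F i != 0) -> 0 < sabs (\prod_(i <- r) F i).
Proof. by move=> F0; apply/sabs_gt0; elim/big_ind: _ => // x y; exact: mulf_neq0. Qed.

Definition scalar_of_real (r : R) : scalar_field R c :=
  match c return scalar_field R c with
  | RealScalars => r
  | ComplexScalars => (r%:C)%C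
  end.

Lemma sabs_of_real r : sabs (scalar_of_real r) = `|r|.
Proof.
rewrite /scalar_of_real; case: c => //=.
by rewrite expr0n addr0 sqrtr_sqr.
Qed.

Lemma scalar_of_realB r s :
  scalar_of_real r - scalar_of_real s = scalar_of_real (r - s).
Proof. by rewrite /scalar_of_real; case: c => //=; rewrite rmorphB. Qed.

End Scalars.

(** A countable set is Lebesgue null, while the line has infinite measure. *)
Lemma setT_real_uncountable (R : realType) : ~ countable [set: R].
Proof.
move=> /countable_lebesgue_measure0; rewrite -set_itvNyy lebesgue_measure_itv/=.
by move=> /eqP.
Qed.

(** * Sparse index sets and sums supported on them *)

(* When n < f n, the hits are the points of the orbit of 0 under f other than 0, and
   [last_hit f j] is the last point of the orbit before j (0 for j = 0). *)
Section Sparse.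
Context {R : realType}.
Variable f : nat -> nat.
Hypothesis f_gt : forall n, (n < f n)%N.

Fixpoint last_hit (j : nat) : nat :=
  if j is j'.+1 then if f (last_hit j') == j' then j' else last_hit j' else 0.

Definition hit (j : nat) : bool := f (last_hit j) == j.

Lemma last_hitS j : last_hit j.+1 = if hit j then j else last_hit j.
Proof. by []. Qed.

Lemma last_hit_le j : (last_hit j <= j)%N.
Proof. by elim: j => //= j ih; case: ifP => // _; exact: leq_trans ih _. Qed.

Lemma last_hit_homo : {homo last_hit : i j / (i <= j)%N}.
Proof.
apply: homo_leq => [//|j i k|j]; first exact: leq_trans.
by rewrite last_hitS; case: ifP => // _; exact: last_hit_le.
Qed.

Lemma le_f_last_hit j : (j <= f (last_hit j))%N.
Proof.
elim: j => // j ih; rewrite last_hitS /hit; case: (eqVneq (f (last_hit j)) j) => [_|ne].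
  exact: f_gt.
by rewrite ltn_neqAle eq_sym ne.
Qed.

(** The witness is [f (last_hit j)]: [last_hit] stays constant from j up to that index, which is
    therefore a hit. *)
Lemma hit_after j : exists2 h, (j <= h)%N & hit h.
Proof.
exists (f (last_hit j)); first exact: le_f_last_hit.
suff stay i : (j <= i <= f (last_hit j))%N -> last_hit i = last_hit j.
  by rewrite /hit stay// le_f_last_hit leqnn.
elim: i => [|i ih]; first by rewrite leqn0 => /andP[/eqP ->].
rewrite leq_eqVlt => /andP[/orP[/eqP -> //|ji] ij].
rewrite last_hitS /hit ih; last by rewrite -ltnS ji ltnW.
by rewrite gtn_eqF.
Qed.

Lemma last_hit_ge h j : hit h -> (h < j)%N -> (h <= last_hit j)%N.
Proof. by move=> hh hj; have := last_hit_homo hj; rewrite last_hitS hh. Qed.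

(** A geometric majorant of the sum of 2^-(last_hit h) over the hits h >= j: the first one
    contributes 2^-(last_hit j), and the exponents then strictly increase. *)
Definition tail_bound (j : nat) : R := 2 * 2^-1 ^+ last_hit j.

Lemma tail_bound_ge0 j : 0 <= tail_bound j.
Proof. by rewrite mulr_ge0// exprn_ge0// invr_ge0. Qed.

(* At a hit j, last_hit jumps up to j, so the bound drops by at least 2^-(last_hit j); this makes
   the sums over hits telescope. *)
Lemma tail_bound_step (u : R) j : (~~ hit j -> u <= 0) ->
  (hit j -> u <= 2^-1 ^+ last_hit j) -> u <= tail_bound j - tail_bound j.+1.
Proof.
rewrite /tail_bound last_hitS; case: ifP => hj u0 u1; last first.
  by rewrite subrr u0.
apply: le_trans (u1 isT) _.
have lt : (last_hit j < j)%N by rewrite -{2}(eqP hj); exact: f_gt.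
have : (2^-1 : R) ^+ j <= 2^-1 ^+ (last_hit j).+1.
  by apply: ler_wiXn2l => //; lra.
rewrite exprS; lra.
Qed.

(** Coordinate j of B^s x comes from coordinate j + s of x, hence the offset s. From J on only hits
    contribute, and their contributions telescope; the first J terms are left untouched. *)
Lemma sum_sparse_le (u : nat -> R) s J : (forall j, 0 <= u j) ->
  (forall j, (J <= j)%N -> ~~ hit (j + s) -> u j <= 0) ->
  (forall j, (J <= j)%N -> hit (j + s) -> u j <= 2^-1 ^+ last_hit (j + s)) ->
  forall n, \sum_(0 <= j < n) u j <= \sum_(0 <= j < J) u j + tail_bound (J + s).
Proof.
move=> u0 um uh n.
have mono : {homo (fun n => \sum_(0 <= j < n) u j) : i j / (i <= j)%N >-> i <= j}.
  by apply: homo_leq => [//|j i k|j]; [exact: le_trans|rewrite big_nat_recr//= lerDl].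
apply: le_trans (mono n (J + n)%N (leq_addl _ _)) _.
rewrite (@big_cat_nat _ _ _ J)//= ?leq_addr// lerD2l.
suff H m : \sum_(J <= j < J + m) u j <= tail_bound (J + s) - tail_bound (J + m + s).
  by have := H n; have := tail_bound_ge0 (J + n + s); lra.
elim: m => [|m ih]; first by rewrite big_geq ?addn0// subrr.
rewrite addnS big_nat_recr/= ?leq_addr//.
have := @tail_bound_step (u (J + m)%N) (J + m + s)%N (um _ (leq_addr _ _)) (uh _ (leq_addr _ _)).
by rewrite -addSn; lra.
Qed.

End Sparse.

(** * Lower and upper limits of nonnegative sequences *)

Section Limits.
Context {R : realType}.
Implicit Type u : nat -> R.

Lemma limn_esup_eq0 u : (forall n, 0 <= u n) ->
  (forall e, 0 < e -> exists N : nat, forall n, (N <= n)%N -> u n < e) ->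
  limn_esup (fun n => (u n)%:E) = 0%E.
Proof.
move=> u0 hu; apply: (cvg_limn_einf_sup _).2.
apply: cvg_EFin; first exact: nearW.
apply/cvgrPdist_lt => e e0; have [N hN] := hu e e0.
by exists N => // n /= Nn; rewrite sub0r normrN ger0_norm ?hN.
Qed.

Lemma limn_einf_eq0 u : (forall n, 0 <= u n) ->
  (forall e, 0 < e -> forall N : nat, exists2 n, (N <= n)%N & u n < e) ->
  limn_einf (fun n => (u n)%:E) = 0%E.
Proof.
move=> u0 hu; rewrite limn_einf_lim.
rewrite [einfs _](_ : _ = cst 0%E); first exact: lim_cst.
apply/funext => N; apply/eqP; rewrite eq_le; apply/andP; split.
  apply/lee_addgt0Pr => e e0; rewrite add0e; have [n Nn lt] := hu e e0 N.
  apply: (@le_trans _ _ (u n)%:E); last by rewrite lee_fin ltW.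
  by apply: ereal_inf_lbound; exists n.
by apply: le_ereal_inf_tmp => _ [n _ <-]; rewrite lee_fin.
Qed.

Lemma limn_esup_gt0 u (r : R) : 0 < r ->
  (forall N : nat, exists2 n, (N <= n)%N & r <= u n) ->
  (0 < limn_esup (fun n => (u n)%:E))%E.
Proof.
move=> r0 hu; apply: (@lt_le_trans _ _ r%:E); first by rewrite lte_fin.
rewrite limn_esup_lim; apply: lime_ge; first exact: is_cvg_esups.
apply: nearW => N; have [n Nn rn] := hu N.
apply: (@le_trans _ _ (u n)%:E); first by rewrite lee_fin.
by apply: ereal_sup_ubound; exists n.
Qed.

End Limits.

(** * Linear structure of the Köthe space, and comparison of d with the seminorms *)

Section KotheSpace.
Context {R : realType} {c : scalar_kind}.
Local Notation K := (scalar_field R c).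
Variables (p : R) (a : nat -> nat -> R).
Hypotheses (hp : p = 0 \/ 1 <= p) (ha : kothe_matrix a).
Implicit Types x y z : nat -> K.

Lemma kothe_ge0 j k : 0 <= a j k.
Proof. by have /andP[] := ha.2 j k. Qed.

Lemma kothe_homo j : {homo a j : k l / (k <= l)%N >-> k <= l}.
Proof.
apply: homo_leq => [//|s r t|k]; first exact: le_trans.
by have /andP[] := ha.2 j k.
Qed.

Lemma kothe_weight_ge0 k x j : 0 <= a j k * sabs (x j).
Proof. by rewrite mulr_ge0 ?kothe_ge0 ?sabs_ge0. Qed.

Lemma kothe_seminorm_ge k x j : kothe_space p a x ->
  a j k * sabs (x j) <= kothe_seminorm p a k x.
Proof.
by move=> xX; apply: (seq_norm_ge j hp (kothe_weight_ge0 k x)); exact: xX.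
Qed.

Lemma kothe_space0 : kothe_space p a (fun=> 0 : K).
Proof.
move=> k; apply: (seq_mem_bounded_sums (S := 0) hp _ _).1 => [j|n].
  exact: kothe_weight_ge0.
by rewrite big1// => j _; rewrite sabs0 mulr0.
Qed.

Lemma kothe_spaceZ (s : K) x : kothe_space p a x ->
  kothe_space p a (fun j => s * x j).
Proof.
move=> xX k; apply: (@seq_mem_dom _ _ _ (fun j => a j k * sabs (x j)) (sabs s) hp _ _ _ _).1.
- exact: sabs_ge0.
- exact: kothe_weight_ge0.
- by move=> j; rewrite (kothe_weight_ge0 k (fun j => s * x j))/= sabsM mulrCA.
- exact: xX.
Qed.

Lemma kothe_spaceB x y : kothe_space p a x -> kothe_space p a y ->
  kothe_space p a (fun j => x j - y j).
Proof.
move=> xX yX k.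
apply: (@seq_mem_dom _ _ _ (fun j => a j k * sabs (x j) + a j k * sabs (y j)) 1 hp _ _ _ _).1 => //.
- by move=> j; rewrite addr_ge0 ?kothe_weight_ge0.
- move=> j; rewrite (kothe_weight_ge0 k (fun j => x j - y j))/= mul1r -mulrDr.
  by rewrite ler_wpM2l ?kothe_ge0// -(sabsN (y j)) le_sabsD.
- by apply: seq_memD => //; [exact: kothe_weight_ge0..|exact: xX|exact: yX].
Qed.

Variable d : (nat -> K) -> (nat -> K) -> R.
Hypothesis hd : kothe_metric p a d.

Lemma kothe_metric_sub x y : kothe_space p a x -> kothe_space p a y ->
  d x y = d (fun=> 0) (fun j => y j - x j).
Proof.
move=> xX yX; have [_ tr _] := hd.
have nX : kothe_space p a (fun j => - x j).
  have := kothe_spaceB kothe_space0 xX.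
  by congr (kothe_space p a); apply/funext => j; rewrite sub0r.
rewrite -(tr _ _ _ xX yX nX); congr (d _ _); apply/funext => j.
by rewrite subrr.
Qed.

Lemma metric_ball_open x (e : R) : kothe_space p a x ->
  metric_open (kothe_space p a) d [set y | kothe_space p a y /\ d x y < e].
Proof.
move=> xX; have [[d0 _ _ dtri] _ _] := hd.
split=> [y [//]|y [yX xy]]; exists (e - d x y); first by rewrite subr_gt0.
by move=> z zX yz; split => //; have := dtri _ _ _ xX yX zX; lra.
Qed.

(** The d-ball about 0 is open for d, hence for the seminorm topology, so it contains a basic
    neighbourhood of 0. *)
Lemma metric_small (e : R) : 0 < e -> exists m : nat, exists2 r : R, 0 < r &
  forall y, kothe_space p a y ->
    (forall k, (k <= m)%N -> kothe_seminorm p a k y < r) -> d (fun=> 0) y < e.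
Proof.
move=> e0; have [[_ d0 _ _] _ dopen] := hd.
have [_ /(_ (fun=> 0))] := (dopen _).1 (metric_ball_open e kothe_space0).
case=> [|m [r r0 hr]].
  by split; [exact: kothe_space0|rewrite (d0 _ _ _ _).2//; exact: kothe_space0].
exists m; exists r; first exact: r0.
move=> y yX hy; suff [] : kothe_space p a y /\ d (fun=> 0) y < e by [].
apply: hr; first exact: yX.
move=> k km; have -> : (fun j => y j - 0) = y by apply/funext => j; rewrite subr0.
exact: hy.
Qed.

(* Stated for sup_j a_{j,k} |y_j| rather than for the seminorm: its balls are open by
   coordinatewise estimates, without Minkowski's inequality. *)
Lemma metric_small_coord k (e : R) : 0 < e -> exists2 r : R, 0 < r &
  forall y, kothe_space p a y -> d (fun=> 0) y < r ->
    forall j, a j k * sabs (y j) < e.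
Proof.
move=> e0; have [_ _ dopen] := hd.
pose U : set (nat -> K) := [set y | kothe_space p a y /\
  exists2 s : R, s < e & forall j, a j k * sabs (y j) <= s].
have /dopen [_ /(_ (fun=> 0))] : kothe_open p a U.
  split=> [y [//]|y [yX [s se ys]]]; exists k, (e - s); first by rewrite subr_gt0.
  move=> z zX /(_ k (leqnn k)) hz; split => //.
  exists (s + kothe_seminorm p a k (fun j => z j - y j)); first by lra.
  move=> j; have := kothe_seminorm_ge k j (kothe_spaceB zX yX).
  have := ys j; have : a j k * sabs (z j) <= a j k * sabs (y j) + a j k * sabs (z j - y j).
    rewrite -mulrDr ler_wpM2l ?kothe_ge0// -{1}(subrKC (y j) (z j)).
    exact: le_sabsD.
  lra.
case=> [|r r0 hr].
  by split; [exact: kothe_space0|exists 0 => // j; rewrite sabs0 mulr0].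
exists r => // y yX dy j; have [_ [s se ys]] := hr y yX dy.
exact: le_lt_trans (ys j) se.
Qed.

End KotheSpace.

(** * Iterates, boundedness and continuity of the shift *)

Section Shift.
Context {R : realType} {c : scalar_kind}.
Local Notation K := (scalar_field R c).
Variables (p : R) (a : nat -> nat -> R) (w : nat -> K).
Hypotheses (hp : p = 0 \/ 1 <= p) (ha : kothe_matrix a).
Hypotheses (ha0 : forall j k, a j k != 0) (hw : forall n, w n != 0).
Hypothesis hB : set_fun (kothe_space p a) (kothe_space p a) (bshift w).
Implicit Types x y : nat -> K.

(** The factor with which B^n carries coordinate i + n to i; start and length are used instead of
    endpoints, so that n = 0 gives the empty product. *)
Definition weight_prod (i n : nat) : R := sabs (\prod_(i <= m < i + n) w m).

Lemma kothe_gt0 j k : 0 < a j k.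
Proof. by rewrite lt_neqAle eq_sym ha0 kothe_ge0. Qed.

Lemma weight_prod_gt0 i n : 0 < weight_prod i n.
Proof. exact: sabs_prod_gt0. Qed.

Lemma iter_bshiftE n x i :
  iter n (bshift w) x i = (\prod_(i <= m < i + n) w m) * x (i + n)%N.
Proof.
elim: n i => [|n ih] i; first by rewrite /= addn0 big_geq// mul1r.
by rewrite iterS /bshift ih addSnnS mulrA -big_ltn// -addSnnS leq_addr.
Qed.

Lemma sabs_iter_bshift n x i :
  sabs (iter n (bshift w) x i) = weight_prod i n * sabs (x (i + n)%N).
Proof. by rewrite iter_bshiftE sabsM. Qed.

Lemma iter_bshift_space n x : kothe_space p a x ->
  kothe_space p a (iter n (bshift w) x).
Proof. by move=> xX; elim: n => [|n ih]; [exact: xX|exact: (hB ih)]. Qed.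

(** The value at a hit is indexed by the preceding orbit point: one choice made at n fixes both the
    next position [f n] and the size [v n] placed there. *)
Definition sparse_vec (f : nat -> nat) (v : nat -> R) (j : nat) : K :=
  if hit f j then scalar_of_real (v (last_hit f j)) else 0.

Lemma sabs_sparse_vec f v j : (forall n, 0 <= v n) ->
  sabs (sparse_vec f v j) = if hit f j then v (last_hit f j) else 0.
Proof.
by move=> v0; rewrite /sparse_vec; case: ifP => _; rewrite ?sabs0 ?sabs_of_real ?ger0_norm.
Qed.

Lemma sparse_vec_space f v : (forall n, n < f n)%N -> (forall n, 0 <= v n) ->
  (forall n r, (r <= n)%N -> a (f n) r * v n <= 2^-1 ^+ n) ->
  kothe_space p a (sparse_vec f v).
Proof.
move=> fgt v0 av r; have [h rh hh] := hit_after fgt r.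
apply: (seq_mem_bounded_sums hp (kothe_weight_ge0 ha r _) _).1.
apply: (@sum_sparse_le R f fgt _ 0 h.+1).
- exact: kothe_weight_ge0.
- by move=> j _; rewrite addn0 sabs_sparse_vec// => /negbTE ->; rewrite mulr0.
- move=> j hj; rewrite addn0 sabs_sparse_vec// => jh; rewrite jh.
  rewrite -{1}(eqP jh); apply: av; apply: leq_trans rh _.
  exact: last_hit_ge.
Qed.

(** If no l works, a sparse x in the space can be chosen whose image has r-th weighted coordinates
    equal to 1 arbitrarily far out, so that its tails are not small and B x leaves the space. *)
Lemma bshift_bounded r : exists l : nat, exists2 C : R, 0 < C &
  forall j, a j r * sabs (w j) <= C * a j.+1 l.
Proof.
apply: contrapT => unb.
have large l C : 0 < C -> exists j, C * a j.+1 l < a j r * sabs (w j).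
  move=> C0; apply: contrapT => nj; apply: unb; exists l, C => // j.
  by rewrite leNgt; apply/negP => jl; apply: nj; exists j.
have next n : exists q, (n < q)%N && (2 ^+ n * a q n <= a q.-1 r * sabs (w q.-1)).
  (* The sum dominates every ratio with j < n, so an index whose ratio exceeds C satisfies j >= n,
     giving q = j + 1 > n. *)
  pose C : R := 2 ^+ n + \sum_(0 <= j < n) a j r * sabs (w j) / a j.+1 n.
  have t0 j : 0 <= a j r * sabs (w j) / a j.+1 n.
    by rewrite divr_ge0 ?mulr_ge0 ?kothe_ge0 ?sabs_ge0.
  have C2 : 2 ^+ n <= C by rewrite lerDl sumr_ge0.
  have [|j jC] := large n C; first by apply: lt_le_trans C2; rewrite exprn_gt0.
  exists j.+1; apply/andP; split; last first.
    by apply: le_trans (ltW jC); rewrite ler_wpM2r ?kothe_ge0.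
  rewrite ltnS leqNgt; apply/negP => jn; move: jC; apply/negP; rewrite -leNgt.
  rewrite -ler_pdivrMr ?kothe_gt0// /C (bigD1_seq j)/= ?iota_uniq ?mem_index_iota//.
  by rewrite addrCA lerDl addr_ge0 ?exprn_ge0// sumr_ge0.
have [f hf] := choice next.
have fgt n : (n < f n)%N by have /andP[] := hf n.
(* Normalized so that one shift brings coordinate [f n] to weighted size exactly 1. *)
pose v n : R := (a (f n).-1 r * sabs (w (f n).-1))^-1.
have v1 n : 0 < a (f n).-1 r * sabs (w (f n).-1).
  by rewrite mulr_gt0 ?kothe_gt0 ?sabs_gt0.
have v0 n : 0 <= v n by rewrite invr_ge0 ltW.
have xX : kothe_space p a (sparse_vec f v).
  apply: sparse_vec_space => // n s sn; have /andP[_ hn] := hf n.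
  rewrite /v ler_pdivrMr//; apply: le_trans (kothe_homo ha (f n) sn) _.
  by rewrite exprVn -ler_pdivrMl ?invr_gt0 ?exprn_gt0// invrK.
have [N hN] := seq_mem_tail hp (kothe_weight_ge0 ha r _) (hB xX r) ltr01.
have [h Nh hh] := hit_after fgt N.+1.
have [tX] := hN N (leqnn N); apply/negP; rewrite -leNgt.
apply: le_trans (@seq_norm_ge _ _ _ (h.-1 - N)%N hp _ tX); last first.
  by move=> i; exact: kothe_weight_ge0.
have h1 : (0 < h)%N by exact: leq_trans Nh.
rewrite subnK; last by rewrite -ltnS prednK.
rewrite /bshift sabsM prednK// sabs_sparse_vec// hh /v (eqP hh) mulrA divff//.
by have := v1 (last_hit f h); rewrite (eqP hh) => /lt0r_neq0.
Qed.

Lemma bshift_seminorm_le r : exists l : nat, exists2 C : R, 0 < C &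
  forall x, kothe_space p a x ->
    kothe_seminorm p a r (bshift w x) <= C * kothe_seminorm p a l x.
Proof.
have [l [C C0 hC]] := bshift_bounded r; exists l, C => // x xX.
have [sX sle] := seq_norm_succ_le hp (kothe_weight_ge0 ha l x) (xX l).
have := @seq_mem_dom _ p (fun j => a j r * sabs (bshift w x j)) _ C hp (ltW C0) _ _ sX.
case=> [j|j|_ le]; first exact: kothe_weight_ge0.
  rewrite (kothe_weight_ge0 ha r (bshift w x))/= /bshift sabsM !mulrA.
  by rewrite ler_wpM2r ?sabs_ge0.
by apply: le_trans le _; rewrite ler_pM2l.
Qed.

Lemma iter_bshift_bounded n r : exists l : nat, exists2 C : R, 0 < C &
  forall i, a i r * weight_prod i n <= C * a (i + n)%N l.
Proof.
elim: n r => [|n ih] r.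
  exists r, 1 => // i; rewrite addn0 /weight_prod addn0 big_geq//.
  by rewrite sabs1 mul1r mulr1.
have [l1 [C1 C10 h1]] := bshift_bounded r; have [l [C C0 h]] := ih l1.
exists l, (C1 * C) => [|i]; first by rewrite mulr_gt0.
rewrite /weight_prod big_ltn ?sabsM; last by rewrite addnS ltnS leq_addr.
rewrite -addSnnS mulrA; apply: le_trans (_ : C1 * (a i.+1 l1 * weight_prod i.+1 n) <= _).
  by rewrite mulrA ler_wpM2r ?sabs_ge0.
by rewrite -mulrA ler_pM2l.
Qed.

(** One pair (l, C) serves finitely many times and seminorms: seminorms below N reduce to the N-th
    by monotonicity, and the times are merged by maximum and sum. *)
Lemma iter_bshift_bounded_upto N : exists l : nat, exists2 C : R, 0 < C &
  forall n r i, (n <= N)%N -> (r <= N)%N -> a i r * weight_prod i n <= C * a (i + n)%N l.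
Proof.
suff H M : exists l : nat, exists2 C : R, 0 < C &
    forall n i, (n <= M)%N -> a i N * weight_prod i n <= C * a (i + n)%N l.
  have [l [C C0 h]] := H N; exists l, C => // n r i nN rN.
  apply: le_trans (h n i nN); rewrite ler_wpM2r ?(ltW (weight_prod_gt0 _ _))//.
  exact: (kothe_homo ha i rN).
elim: M => [|M [l1 [C1 C10 h1]]].
  have [l [C C0 h]] := iter_bshift_bounded 0 N; exists l, C => // n i.
  by rewrite leqn0 => /eqP ->.
have [l2 [C2 C20 h2]] := iter_bshift_bounded M.+1 N.
exists (maxn l1 l2), (C1 + C2) => [|n i]; first by rewrite addr_gt0.
rewrite leq_eqVlt mulrDl => /orP[/eqP ->|nM].
  apply: le_trans (h2 i) _; apply: ler_wpDl.
    by apply: mulr_ge0; [exact: ltW|exact: kothe_ge0].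
  by rewrite ler_pM2l// (kothe_homo ha)// leq_maxr.
apply: le_trans (h1 n i nM) _; apply: ler_wpDr.
  by apply: mulr_ge0; [exact: ltW|exact: kothe_ge0].
by rewrite ler_pM2l// (kothe_homo ha)// leq_maxl.
Qed.

Variable d : (nat -> K) -> (nat -> K) -> R.
Hypothesis hd : kothe_metric p a d.

Lemma bshift_continuous : metric_continuous (kothe_space p a) d (bshift w).
Proof.
have [[_ d0 _ _] _ dopen] := hd.
move=> x xX e e0.
have /dopen [_ Uopen] := metric_ball_open hd e (hB xX).
(* Continuity at x follows once this preimage of a ball is open for the seminorms; by linearity of
   B, that reduces to seminorm bounds at 0. *)
pose V := [set y | kothe_space p a y /\ d (bshift w x) (bshift w y) < e].
have /dopen [_ /(_ x) []] : kothe_open p a V; last first.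
- by move=> r r0 hr; exists r => // y yX xy; have [] := hr y yX xy.
- by split; [exact: xX|rewrite (d0 _ _ (hB xX) (hB xX)).2].
split=> [y [//]|y [yX xy]].
have [m [r r0 hr]] := Uopen (bshift w y) (conj (hB yX) xy).
suff [m' [r' r'0 hm']] : exists m' : nat, exists2 r' : R, 0 < r' &
    forall x, kothe_space p a x ->
      (forall k, (k <= m')%N -> kothe_seminorm p a k x < r') ->
      (forall k, (k <= m)%N -> kothe_seminorm p a k (bshift w x) < r).
  exists m'; exists r'; first exact: r'0.
  move=> z zX hz; split; first exact: zX.
  apply: (hr _ (hB zX) _).2 => k km.
  have -> : (fun j => bshift w z j - bshift w y j) = bshift w (fun j => z j - y j).
    by apply/funext => j; rewrite /bshift mulrBr.
  by apply: (hm' _ (kothe_spaceB hp ha zX yX) hz).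
elim: m {hr} => [|m [m1 [r1 r10 h1]]].
  have [l [C C0 hC]] := bshift_seminorm_le 0.
  exists l, (r / C) => [|z zX hz k]; first by rewrite divr_gt0.
  rewrite leqn0 => /eqP ->; apply: le_lt_trans (hC z zX) _.
  by rewrite mulrC -ltr_pdivlMr// hz.
have [l [C C0 hC]] := bshift_seminorm_le m.+1.
exists (maxn m1 l), (Num.min r1 (r / C)) => [|z zX hz k].
  by rewrite lt_min r10 divr_gt0.
rewrite leq_eqVlt => /orP[/eqP ->|km].
  apply: le_lt_trans (hC z zX) _; rewrite mulrC -ltr_pdivlMr//.
  by have := hz l (leq_maxr _ _); rewrite lt_min => /andP[].
apply: h1 => // j jm; have := hz j (leq_trans jm (leq_maxl _ _)).
by rewrite lt_min => /andP[].
Qed.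

End Shift.

Lemma eventually_upto (P : nat -> nat -> Prop) (m : nat) :
  (forall k, exists N : nat, forall n, (N <= n)%N -> P k n) ->
  exists N : nat, forall n, (N <= n)%N -> forall k, (k <= m)%N -> P k n.
Proof.
move=> /choice [N hN]; exists (\max_(k < m.+1) N k)%N => n Nn k km.
apply: hN; apply: leq_trans Nn.
exact: (leq_bigmax (Ordinal (km : k < m.+1)%N)).
Qed.

Lemma uncountable_two (T : Type) (S : set T) : ~ countable S ->
  exists x y, [/\ S x, S y & x <> y].
Proof.
move=> unc; apply: contrapT => one; apply: unc.
have [->|/set0P [x Sx]] := eqVneq S set0; first exact: countable0.
apply: sub_countable (countable1 x); apply: subset_card_le => y Sy.
by apply: contrapT => yx; apply: one; exists y, x; split.
Qed.

(** * Li-Yorke chaos and the unbounded weight ratios *)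

Section Chaos.
Context {R : realType} {c : scalar_kind}.
Local Notation K := (scalar_field R c).
Variables (p : R) (a : nat -> nat -> R) (w : nat -> K).
Hypotheses (hp : p = 0 \/ 1 <= p) (ha : kothe_matrix a).
Hypotheses (ha0 : forall j k, a j k != 0) (hw : forall n, w n != 0).
Hypothesis hB : set_fun (kothe_space p a) (kothe_space p a) (bshift w).
Implicit Types x y : nat -> K.

(** The positive denominator is cleared and the pair i <= j is replaced by i and the length n = j +
    1 - i, which is why n > 0. *)
Lemma ereal_sup_ratio_pinfty k l :
  ereal_sup [set y : \bar R | exists i j : nat, (i <= j)%N /\
      y = (a i k * sabs (\prod_(i <= m < j.+1) w m) / a j.+1 l)%:E] = +oo%E <->
  forall C, exists i n, (0 < n)%N /\ C * a (i + n)%N l < a i k * weight_prod w i n.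
Proof.
split=> [supoo C|unb].
  apply: contrapT => bnd.
  suff : (ereal_sup [set y : \bar R | exists i j : nat, (i <= j)%N /\
      y = (a i k * sabs (\prod_(i <= m < j.+1) w m) / a j.+1 l)%:E] <= C%:E)%E.
    by rewrite supoo.
  apply: ge_ereal_sup => _ [i [j [ij ->]]]; rewrite lee_fin.
  rewrite ler_pdivrMr ?kothe_gt0// leNgt; apply/negP => lt; apply: bnd.
  have e : (i + (j.+1 - i))%N = j.+1 by rewrite subnKC// ltnW.
  by exists i, (j.+1 - i)%N; rewrite subn_gt0 ltnS /weight_prod e.
apply/eqyP => C C0; have [i [n [n0 lt]]] := unb C.
apply: (@le_trans _ _ (a i k * weight_prod w i n / a (i + n)%N l)%:E).
  by rewrite lee_fin ler_pdivlMr ?kothe_gt0// ltW.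
apply: ereal_sup_ubound; exists i, (i + n).-1.
have e : (i + n).-1.+1 = (i + n)%N by rewrite prednK// addn_gt0 n0 orbT.
by rewrite -ltnS e -{1}(addn0 i) ltn_add2l.
Qed.

Variable d : (nat -> K) -> (nat -> K) -> R.
Hypothesis hd : kothe_metric p a d.

Lemma iter_bshift_small :
  (forall k, exists l, exists C : R, forall i n, (0 < n)%N ->
     a i k * weight_prod w i n <= C * a (i + n)%N l) ->
  forall x, kothe_space p a x -> forall e : R, 0 < e ->
  exists N : nat, forall n, (N <= n)%N -> d (fun=> 0) (iter n (bshift w) x) < e.
Proof.
move=> bnd x xX e e0.
have [m [r r0 hr]] := metric_small hp ha hd e0.
suff H k : exists N : nat, forall n, (N <= n)%N ->
    kothe_seminorm p a k (iter n (bshift w) x) < r.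
  have [N hN] := eventually_upto m H; exists N => n Nn.
  by apply: hr; [exact: iter_bshift_space|exact: hN].
(* C may be any real; the maximum with 1 makes it positive. *)
have [l [C hC]] := bnd k; pose C' := Num.max C 1.
have C'0 : 0 < C' by rewrite lt_max ltr01 orbT.
have rC : 0 < r / C' by rewrite divr_gt0.
have [N hN] := seq_mem_tail hp (kothe_weight_ge0 ha l x) (xX l) rC.
exists N.+1 => n Nn; have [tX tlt] := hN n (ltnW Nn).
have := @seq_mem_dom _ p (fun i => a i k * sabs (iter n (bshift w) x i)) _ C' hp (ltW C'0) _ _ tX.
case=> [j|j|_ le]; first exact: kothe_weight_ge0.
  rewrite (kothe_weight_ge0 ha k (iter n (bshift w) x))/= sabs_iter_bshift !mulrA.
  rewrite ler_wpM2r ?sabs_ge0//; apply: le_trans (hC j n (leq_ltn_trans (leq0n _) Nn)) _.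
  by rewrite ler_wpM2r ?kothe_ge0// le_max lexx.
by apply: le_lt_trans le _; rewrite mulrC -ltr_pdivlMr.
Qed.

Lemma li_yorke_chaotic_unbounded :
  li_yorke_chaotic (kothe_space p a) d (bshift w) ->
  exists k : nat, forall l : nat,
    forall C, exists i n, (0 < n)%N /\ C * a (i + n)%N l < a i k * weight_prod w i n.
Proof.
move=> [_ _ [S [SX /uncountable_two [x [y [Sx Sy xy]]] scr]]].
apply: contrapT => nunb.
have bnd k : exists l, exists C : R, forall i n, (0 < n)%N ->
     a i k * weight_prod w i n <= C * a (i + n)%N l.
  apply: contrapT => nk; apply: nunb; exists k => l C; apply: contrapT => nC.
  apply: nk; exists l, C => i n n0; rewrite leNgt; apply/negP => lt.
  by apply: nC; exists i, n.
have [xX yX] := (SX _ Sx, SX _ Sy).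
have [_] := scr x y Sx Sy xy.
have [[dge0 _ _ _] _ _] := hd.
rewrite limn_esup_eq0 ?ltxx// => [n|e e0].
  by apply: dge0; exact: iter_bshift_space.
have [N hN] := iter_bshift_small bnd (kothe_spaceB hp ha yX xX) e0.
exists N => n Nn; apply: le_lt_trans (hN n Nn).
rewrite [leLHS](kothe_metric_sub hp ha hd); [|exact: iter_bshift_space..].
(* By linearity the distance of the two orbits is that of the orbit of y - x from 0. *)
rewrite [X in d _ X](_ : _ = iter n (bshift w) (fun j => y j - x j))//.
by apply/funext => i; rewrite !iter_bshiftE mulrBr.
Qed.

Variable k : nat.
Hypothesis unb : forall l : nat, forall C : R, exists i n : nat,
  (0 < n)%N /\ C * a (i + n)%N l < a i k * weight_prod w i n.

Lemma weight_prod0 i : weight_prod w i 0 = 1.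
Proof. by rewrite /weight_prod addn0 big_geq// sabs1. Qed.

(** The pair is (q, i). A ratio above C 2^N, with C bounding all iterates up to time N + 1, makes
    the landing weight at i exceed the images of coordinate q at those times by the factor 2^N. *)
Lemma irregular_step N : exists qi : nat * nat,
  [/\ (qi.2 <= qi.1)%N, (N < qi.1 - qi.2)%N &
    forall n r, (n <= N.+1)%N -> (r <= N)%N -> (n <= qi.1)%N ->
      a (qi.1 - n)%N r * weight_prod w (qi.1 - n) n <=
      2^-1 ^+ N * (a qi.2 k * weight_prod w qi.2 (qi.1 - qi.2))].
Proof.
(* The range includes k because a time n <= N would contradict this same bound in the k-th
   seminorm. *)
have [l [C C0 hC]] := iter_bshift_bounded_upto hp ha ha0 hw hB (maxn N.+1 k).
have [i [n [n0 lt]]] := unb l (C * 2 ^+ N).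
exists (i + n, i)%N; rewrite /= addKn leq_addr; split => //.
  rewrite ltnNge; apply/negP => nN.
  have := hC n k i; rewrite (leq_trans nN) ?leq_maxr ?(leq_trans (leqnSn N)) ?leq_maxl//.
  move=> /(_ isT isT); apply/negP; rewrite -ltNge; apply: le_lt_trans lt.
  rewrite ler_wpM2r ?kothe_ge0// ler_peMr ?(ltW C0)//.
  by rewrite exprn_ege1// ler1n.
move=> m r mN rN mn.
have := hC m r (i + n - m)%N; rewrite subnK// => /(_ _ _)/le_trans; apply.
- exact: leq_trans (leq_maxl _ _).
- by apply: leq_trans (leq_maxl _ _); rewrite (leq_trans rN).
- rewrite exprVn ler_pdivlMl ?exprn_gt0// mulrA [_ * C]mulrC; exact: ltW.
Qed.

Lemma unbounded_li_yorke_chaotic :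
  li_yorke_chaotic (kothe_space p a) d (bshift w).
Proof.
split=> //; first exact: bshift_continuous.
have [F hF] := choice irregular_step.
pose f n := (F n).1; pose g n := (F n).2.
have gf n : (g n <= f n)%N by have [] := hF n.
have fg n : (n < f n - g n)%N by have [] := hF n.
have fgt n : (n < f n)%N by rewrite (leq_trans (fg n))// leq_subr.
(* With the inverse of [v1 n] at coordinate [f n], the image at time [f n - g n] has k-th weight
   exactly 1 at index [g n]. *)
pose v1 n : R := a (g n) k * weight_prod w (g n) (f n - g n).
have v1_gt0 n : 0 < v1 n.
  by apply: mulr_gt0; [exact: kothe_gt0|exact: weight_prod_gt0].
pose v n := (v1 n)^-1.
have v0 n : 0 <= v n by rewrite invr_ge0 ltW.
have small N n r : (n <= N.+1)%N -> (r <= N)%N -> (n <= f N)%N ->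
    a (f N - n)%N r * (weight_prod w (f N - n) n * v N) <= 2^-1 ^+ N.
  move=> nN rN nf; rewrite mulrA ler_pdivrMr//.
  by have [_ _] := hF N; exact.
pose x : nat -> K := sparse_vec f v.
have xX : kothe_space p a x.
  apply: sparse_vec_space => // n r rn.
  by have := @small n 0 r; rewrite subn0 weight_prod0 mul1r; exact.
pose phi (s : R) : nat -> K := fun j => scalar_of_real s * x j.
have phiX s : kothe_space p a (phi s) by exact: kothe_spaceZ.
have iterX n : kothe_space p a (iter n (bshift w) x) by exact: iter_bshift_space.
have dphi s t n : d (iter n (bshift w) (phi s)) (iter n (bshift w) (phi t)) =
    d (fun=> 0) (fun j => scalar_of_real (t - s) * iter n (bshift w) x j).
  rewrite (kothe_metric_sub hp ha hd (iter_bshift_space hB n (phiX s))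
    (iter_bshift_space hB n (phiX t))).
  congr (d _ _); apply/funext => j; rewrite !iter_bshiftE /phi -scalar_of_realB.
  by ring.
have [[dge0 _ _ _] _ _] := hd.
exists (range phi); split.
- by move=> _ [s _ <-]; exact: phiX.
- have phi_inj : injective phi.
    move=> s t st; have [h _ hh] := hit_after fgt 0.
    apply/eqP; rewrite -subr_eq0 -normr_eq0 -(@sabs_of_real _ c).
    have xh : sabs (x h) != 0.
      by rewrite sabs_sparse_vec// hh invr_eq0 gt_eqF.
    rewrite -(mulIr_eq0 _ (mulIf xh)) -sabsM -scalar_of_realB mulrBl.
    by have /(congr1 (fun y => y h)) := st; rewrite /phi => ->; rewrite subrr sabs0.
  rewrite (eq_countable (inj_card_eq (in2W phi_inj))).
  exact: setT_real_uncountable.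
move=> _ _ [s _ <-] [t _ <-] st.
have r0 : 0 < `|t - s|.
  by rewrite normr_gt0 subr_eq0; apply/eqP => ts; apply: st; rewrite ts.
split.
- apply: limn_einf_eq0 => [n|e e0 N].
    exact: dge0 (iter_bshift_space hB n (phiX s)) (iter_bshift_space hB n (phiX t)).
  have [m [r rgt0 hr]] := metric_small hp ha hd e0.
  (* At a hit h, [last_hit f h.+1] is h, so the bound to be beaten by r is |t - s| times 2 *
     2^-h. *)
  have c0 : 0 < r / (2 * `|t - s|) by rewrite divr_gt0// mulr_gt0.
  have : `|2^-1 : R| < 1 by rewrite ger0_norm; lra.
  move=> /cvg_expr /cvgrPdist_lt /(_ _ c0) [J _ hJ].
  have [h hle hh] := hit_after fgt (maxn N (maxn m J)).
  move: hle; rewrite !geq_max => /and3P[Nh mh Jh].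
  exists h.+1; first exact: leq_trans Nh _.
  rewrite dphi; apply: hr; first exact: (kothe_spaceZ hp ha _ (iterX _)).
  move=> l lm.
  (* At time h + 1 the coordinates up to h are gone. A remaining hit has [last_hit] >= h, so this
     time is at most [last_hit] + 1, the largest time allowed in [small]; no initial terms remain,
     hence J = 0. *)
  have iterle : kothe_seminorm p a l (iter h.+1 (bshift w) x) <= tail_bound f h.+1.
    apply: (seq_mem_bounded_sums hp (kothe_weight_ge0 ha l _) _).2.
    have := @sum_sparse_le R f fgt (fun j => a j l * sabs (iter h.+1 (bshift w) x j)) h.+1 0.
    rewrite big_geq// add0r add0n; apply.
    + exact: kothe_weight_ge0.
    + move=> j _ /negbTE jh.
      by rewrite sabs_iter_bshift sabs_sparse_vec// jh !mulr0.
    + move=> j _ jh; rewrite sabs_iter_bshift sabs_sparse_vec// jh.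
      have hl : (h <= last_hit f (j + h.+1))%N.
        by apply: last_hit_ge => //; rewrite addnS ltnS leq_addl.
      have := @small (last_hit f (j + h.+1)) h.+1 l; rewrite (eqP jh) addnK; apply.
      * by [].
      * exact: leq_trans lm (leq_trans mh hl).
      * exact: leq_addl.
  have := @seq_mem_dom _ p
     (fun j => a j l * sabs (scalar_of_real (t - s) * iter h.+1 (bshift w) x j))
     (fun j => a j l * sabs (iter h.+1 (bshift w) x j)) `|t - s| hp (ltW r0) _ _ (iterX _ l).
  case=> [j|j|_ le]; first exact: kothe_weight_ge0.
    rewrite (kothe_weight_ge0 ha l (fun j => scalar_of_real (t - s) * iter h.+1 (bshift w) x j))/=.
    by rewrite sabsM sabs_of_real mulrCA.
  apply: le_lt_trans le _.
  apply: (@le_lt_trans _ _ (`|t - s| * tail_bound f h.+1)).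
    by rewrite ler_wpM2l ?(ltW r0).
  have := hJ h Jh; rewrite /= sub0r normrN ger0_norm ?exprn_ge0 ?invr_ge0//.
  rewrite ltr_pdivlMr ?mulr_gt0// /tail_bound last_hitS hh.
  by rewrite mulrCA mulrA [_ * (2 * _)]mulrC.
- have [rho rho0 hrho] := metric_small_coord hp ha hd k r0.
  apply: (limn_esup_gt0 rho0) => N.
  (* A hit h beyond another hit h0 >= N has [last_hit f h] >= N, which forces the landing time
     [h - g (last_hit f h)] past N. *)
  have [h0 Nh0 hh0] := hit_after fgt N.
  have [h h0h hh] := hit_after fgt h0.+1.
  have hl := last_hit_ge hh0 h0h.
  exists (h - g (last_hit f h))%N.
    have := fg (last_hit f h); rewrite (eqP hh); apply: leq_trans.
    exact: leq_trans Nh0 (leq_trans hl (leqnSn _)).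
  (* A distance below rho would make every weighted coordinate smaller than |t - s|, yet the landing
     coordinate equals |t - s|. *)
  rewrite dphi leNgt; apply/negP => lt.
  have := hrho _ (kothe_spaceZ hp ha _ (iterX _)) lt (g (last_hit f h)).
  rewrite sabsM sabs_iter_bshift sabs_of_real.
  have gh : (g (last_hit f h) <= h)%N by rewrite -{2}(eqP hh) gf.
  have v1h : v1 (last_hit f h) =
      a (g (last_hit f h)) k * weight_prod w (g (last_hit f h)) (h - g (last_hit f h)).
    by rewrite /v1 (eqP hh).
  rewrite subnKC// sabs_sparse_vec// hh mulrCA [a _ _ * _]mulrA -v1h /v.
  by rewrite divff ?gt_eqF// mulr1 ltxx.
Qed.

End Chaos.

Theorem theorem23 (R : realType) (c : scalar_kind) (p : R)
    (hp : p = 0 \/ 1 <= p)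
    (a : nat -> nat -> R) (ha : kothe_matrix a)
    (ha0 : forall j k, a j k != 0)
    (w : nat -> scalar_field R c) (hw : forall n, w n != 0)
    (hB : set_fun (kothe_space p a) (kothe_space p a) (bshift w))
    (d : (nat -> scalar_field R c) -> (nat -> scalar_field R c) -> R)
    (hd : kothe_metric p a d) :
  li_yorke_chaotic (kothe_space p a) d (bshift w) <->
  exists k : nat, forall l : nat,
    ereal_sup [set y : \bar R | exists i j : nat, (i <= j)%N /\
      y = (a i k * sabs (\prod_(i <= m < j.+1) w m) / a j.+1 l)%:E] = +oo%E.
Proof.
split=> [lyc|[k hk]].
  have [k hk] := li_yorke_chaotic_unbounded hp ha hB hd lyc.
  by exists k => l; apply/(ereal_sup_ratio_pinfty w ha ha0).
apply: (unbounded_li_yorke_chaotic hp ha ha0 hw hB hd (k := k)) => l.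
exact/(ereal_sup_ratio_pinfty w ha ha0).
Qed.
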